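(* Let $G=(V,E)$ be a finite connected $d$-regular graph, and let $\Sigma\subset V$ separate $V\setminus\Sigma$ into $V^+$ and $V^-$, with signed distance $\mathrm{dist}_\Sigma$. Let $\alpha=|\Sigma|/|V|$ and assume $\alpha<1/4$. If $|\Sigma|\ge|\mathrm{dist}_\Sigma^{-1}(k)|$ for all $k\in\mathbb{Z}$, then $\lambda_2(G)\le 8\alpha^2+o(\alpha^2)$, where $o(\alpha^2)$ denotes a quantity depending only on $\alpha$ whose ratio to $\alpha^2$ tends to $0$ as $\alpha\to0$.
   Context: The (normalized) Laplacian is $\Delta f(x)=\frac1d\sum_{y\sim x}(f(x)-f(y))$, with eigenvalues $0=\lambda_1(G)\le\lambda_2(G)\le\cdots$. $\Sigma$ separates $V\setminus\Sigma$ into $V^+,V^-$ if $V\setminus\Sigma=V^+\sqcup V^-$ with no edges between $V^+$ and $V^-$; the signed distance $\mathrm{dist}_\Sigma$ has absolute value equal to the graph distance to $\Sigma$, positive on $V^+$ and negative on $V^-$. *)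

(* Defs.v *)
From HB Require Import structures.
From mathcomp Require Import all_boot all_order all_algebra.
From mathcomp Require Import polyrcf complex.
From mathcomp Require Import all_classical all_reals all_analysis.

Set Implicit Arguments.
Unset Strict Implicit.
Unset Printing Implicit Defensive.

Import Order.TTheory GRing.Theory Num.Theory.
Import numFieldNormedType.Exports.

Local Open Scope ring_scope.

Section Spectrum.
Variable R : rcfType.

(* The real eigenvalues of A in nondecreasing order, each repeated according to
   its multiplicity as a root of the characteristic polynomial. *)
Definition eigenvalues n (A : 'M[R]_n) : seq R :=
  let p := char_poly A in
  flatten [seq nseq (mup x p) x | x <- rootsR p].

End Spectrum.

Section Graph.
Variable T : finType.
Implicit Types (e : rel T) (S Vp Vm : {set T}).

Definition simple_graph e := symmetric e /\ irreflexive e.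

Definition connected_graph e := forall x y, connect e x y.

Definition regular_graph e (d : nat) := forall x, #|[set y | e x y]| = d.

(* Least length of a path from x to y; equal to #|T| when there is none. *)
Definition graph_dist e (x y : T) : nat :=
  find (fun n => [exists p : n.-tuple T, path e x p && (last x p == y)])
       (iota 0 #|T|).

Definition dist_to e S (x : T) : nat :=
  \big[minn/#|T|]_(y in S) graph_dist e x y.

Definition separates e S Vp Vm :=
  [/\ ~: S = Vp :|: Vm, [disjoint Vp & Vm] &
      forall x y, x \in Vp -> y \in Vm -> ~~ e x y].

Definition signed_dist e S Vp (x : T) : int :=
  if x \in Vp then (dist_to e S x)%:Z else - (dist_to e S x)%:Z.

Section Laplacian.
Variable R : realType.

Definition laplacian e (d : nat) (f : T -> R) (x : T) : R :=
  d%:R^-1 * \sum_(y | e x y) (f x - f y).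

(* Matrix of the Laplacian in the basis of indicator functions of vertices. *)
Definition laplacian_mx e (d : nat) : 'M[R]_#|T| :=
  \matrix_(i, j) laplacian e d (fun x => (x == enum_val j)%:R) (enum_val i).

(* Indices start at 1. *)
Definition lambda e (d k : nat) : R := (eigenvalues (laplacian_mx e d))`_k.-1.

End Laplacian.
End Graph.

(* For symmetric A, [eigenvalues A] is the whole spectrum, so that
   [lambda e d k] is a genuine eigenvalue for 1 <= k <= #|T|. *)
Section SpectrumFacts.
Variable R : rcfType.
Local Notation C := (complex R).
Local Notation toC := (real_complex R).

Lemma symmetric_eigenvalue_real n (A : 'M[R]_n) (z : C) :
  A^T = A -> eigenvalue (map_mx toC A) z -> z \is Num.real.
Proof.
move=> symA /eigenvalueP [v vA v0].
set B := map_mx toC A in vA.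
pose w := (map_mx Num.conj v)^T.
have BJ : map_mx Num.conj B = B.
  by apply/matrixP => i j; rewrite !mxE; apply: conjc_real.
have BT : B^T = B by rewrite /B map_trmx symA.
have wE : B *m w = Num.conj z *: w.
  have := congr1 (fun M => (map_mx Num.conj M)^T) vA.
  by rewrite map_mxM trmx_mul BJ BT map_mxZ linearZ.
have E : z *: (v *m w) = Num.conj z *: (v *m w).
  by rewrite scalemxAl -vA -mulmxA wE scalemxAr.
have nz : (v *m w) 0 0 != 0.
  apply: contra v0 => /eqP; rewrite !mxE => /eqP.
  rewrite psumr_eq0; last by move=> i _; rewrite !mxE mul_conjC_ge0.
  move=> /allP H; apply/eqP/rowP => i; rewrite mxE.
  by have := H i (mem_index_enum _); rewrite !mxE mul_conjC_eq0 => /eqP.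
move/matrixP: E => /(_ 0 0); rewrite mxE [in RHS]mxE => /(mulIf nz) E.
by apply/CrealP; rewrite -E.
Qed.

Lemma char_poly_split n (A : 'M[R]_n) : A^T = A ->
  exists s : seq R, char_poly A = \prod_(x <- s) ('X - x%:P).
Proof.
move=> symA.
have [r Er] := closed_field_poly_normal (char_poly (map_mx toC A)).
have lc : lead_coef (char_poly (map_mx toC A)) = 1 by apply/monicP/char_poly_monic.
rewrite lc scale1r in Er.
have rr z : z \in r -> z = toC (complex.Re z).
  move=> zr; apply/esym/RRe_real/(symmetric_eigenvalue_real symA).
  by rewrite eigenvalue_root_char Er root_prod_XsubC.
exists (map (@complex.Re R) r).
apply: (map_poly_inj toC); rewrite map_char_poly Er big_map rmorph_prod.
apply: eq_big_seq => z zr.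
by rewrite rmorphB /= map_polyX map_polyC /= [in LHS](rr z zr).
Qed.

Lemma eigenvalues_perm n (A : 'M[R]_n) (s : seq R) :
  char_poly A = \prod_(x <- s) ('X - x%:P) -> perm_eq (eigenvalues A) s.
Proof.
move=> Es; rewrite /eigenvalues /=.
have p0 : char_poly A != 0 by apply: monic_neq0; apply: char_poly_monic.
apply/allP => x _ /=; apply/eqP; rewrite -[RHS]mu_prod_XsubC -Es.
rewrite count_flatten -map_comp sumnE big_map.
have cE y : count_mem x (nseq (mup y (char_poly A)) y) =
    (if y == x then mup x (char_poly A) else 0%N).
  rewrite count_nseq /=; case: eqP => [->|] //=; first by rewrite mul1n.
under eq_bigr => y _ do rewrite /= cE.
have [xr|xr] := boolP (x \in rootsR (char_poly A)).
  rewrite (bigD1_seq x) ?uniq_roots //= eqxx.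
  by rewrite big1 ?addn0 // => y /negbTE ->.
rewrite big1_seq; last first.
  by move=> y /andP[_ yr]; case: eqP => // yx; rewrite -yx yr in xr.
rewrite mupNroot //; apply: contra xr => xr.
by have := roots_on_rootsR p0 x; rewrite xr andbT => <-.
Qed.

Lemma char_poly_eigenvalues n (A : 'M[R]_n) : A^T = A ->
  char_poly A = \prod_(x <- eigenvalues A) ('X - x%:P).
Proof.
move=> /char_poly_split [s Es].
by rewrite (perm_big _ (eigenvalues_perm Es)) -Es.
Qed.

Lemma size_eigenvalues n (A : 'M[R]_n) : A^T = A -> size (eigenvalues A) = n.
Proof.
move=> /char_poly_eigenvalues E.
by have := size_char_poly A; rewrite E size_prod_XsubC => -[].
Qed.

Lemma sorted_eigenvalues n (A : 'M[R]_n) : sorted <=%R (eigenvalues A).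
Proof.
rewrite /eigenvalues; set p := char_poly A.
have : sorted <%R (rootsR p) by rewrite sorted_roots.
rewrite lt_sorted_pairwise le_sorted_pairwise.
elim: (rootsR p) => //= x s IH /andP[xs ps].
rewrite pairwise_cat IH // andbT; apply/andP; split.
  apply/allrelP => y z /nseqP [-> _] /flattenP [t /mapP [u us ->]].
  by move=> /nseqP [-> _]; apply/ltW; move/allP: xs; apply.
elim: (mup x p) => //= k ->; rewrite andbT; apply/allP => y /nseqP[-> _].
exact: lexx.
Qed.

End SpectrumFacts.

Lemma laplacian_mx_sym (T : finType) (R : realType) (e : rel T) (d : nat) :
  simple_graph e -> regular_graph e d ->
  (laplacian_mx R e d)^T = laplacian_mx R e d.
Proof.
move=> [se ie] rg; apply/matrixP => i j; rewrite !mxE /laplacian; congr (_ * _).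
have sE a b : \sum_(y | e a y) ((a == b)%:R - (y == b)%:R) =
    d%:R * (a == b)%:R - (e a b)%:R :> R.
  rewrite sumrB sumr_const -cardsE rg mulr_natl; congr (_ - _).
  have [ab|ab] := boolP (e a b).
    by rewrite (bigD1 b) //= eqxx big1 ?addr0 // => y /andP[_ /negbTE ->].
  by rewrite big1 // => y ay; case: eqP => // yb; rewrite -yb ay in ab.
by rewrite !sE eq_sym se.
Qed.

(* Main.v *)
(** The mean-zero part [g] of the signed distance to [S] is a test function for
    the Rayleigh quotient. The signed distance varies by at most 1 along an
    edge, so the energy of [g] is at most [#|T| / 2]. As every level set has at
    most [#|S|] points, the variance of [g] is almost that of the uniform
    distribution on an interval of length [1 / alpha], i.e. about
    [1 / (12 alpha^2)]. The quotient is thus about [6 alpha^2], and it is at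
    most [8 alpha^2] as soon as [alpha < 1 / 4], so the error term can be taken
    to be zero. *)

Require Import Defs.
From mathcomp Require Import all_boot all_order all_algebra.
From mathcomp Require Import spectral sesquilinear complex.
From mathcomp Require Import all_classical all_reals all_analysis.
From mathcomp Require Import zify ring lra.

Set Implicit Arguments.
Unset Strict Implicit.
Unset Printing Implicit Defensive.

Import Order.TTheory GRing.Theory Num.Theory.
Import numFieldNormedType.Exports.

Local Open Scope ring_scope.

(** * A test-vector bound for the second eigenvalue of a real symmetric matrix *)

Section SecondEigenvalue.
Variable R : rcfType.
Local Notation C := (complex R).
Local Notation toC := (real_complex R).
Local Open Scope sesquilinear_scope.

Lemma map_real_conj m n (M : 'M[R]_(m, n)) :
  (map_mx toC M)^t* = (map_mx toC M)^T.
Proof. by apply/matrixP => i j; rewrite !mxE; apply: conjc_real. Qed.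

Lemma char_poly_conj (F : fieldType) n (P B : 'M[F]_n) :
  P \in unitmx -> char_poly (invmx P *m B *m P) = char_poly B.
Proof.
move=> uP; rewrite /char_poly.
have -> : char_poly_mx (invmx P *m B *m P) =
   map_mx polyC (invmx P) *m char_poly_mx B *m map_mx polyC P.
  rewrite /char_poly_mx mulmxBr mulmxBl -!map_mxM; congr (_ - _).
  rewrite mul_mx_scalar -scalemxAl -map_mxM mulVmx // map_mx1.
  by rewrite scalemx1.
rewrite !det_mulmx mulrC mulrA -det_mulmx -map_mxM mulmxV // map_mx1 det1.
by rewrite mul1r.
Qed.

(** Over the complex numbers [A] is Hermitian, hence unitarily diagonalizable with real diagonal.
    Unitary conjugation keeps the characteristic polynomial, so the diagonal lists [eigenvalues A]
    with multiplicity. *)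
Lemma symmetric_spectral n (A : 'M[R]_n) : A^T = A ->
  exists (P : 'M[C]_n) (s : 'I_n -> R),
    [/\ P \is unitarymx,
        map_mx toC A = P^t* *m diag_mx (\row_i toC (s i)) *m P &
        perm_eq (eigenvalues A) [seq s i | i <- enum 'I_n]].
Proof.
move=> symA; set B := map_mx toC A.
have Bh : B \is hermsymmx.
  by apply/is_hermitianmxP; rewrite expr0 scale1r map_real_conj map_trmx symA.
have Bd := orthomx_spectralP (hermitian_normalmx Bh).
have /mxOverP Dr := hermitian_spectral_diag_real Bh.
set P := spectralmx B in Bd; set D := spectral_diag B in Bd Dr.
have uP : P \is unitarymx by apply: spectral_unitarymx.
pose s i := complex.Re (D 0 i).
have DE : D = \row_i toC (s i).
  by apply/rowP => i; rewrite mxE RRe_real // Dr.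
exists P, s; split=> //; first by rewrite -invmx_unitary // -DE.
apply: eigenvalues_perm; apply: (map_poly_inj toC).
rewrite map_char_poly -/B Bd char_poly_conj ?unitarymx_unit //.
rewrite char_poly_trig ?diag_mx_is_trig // big_map big_enum /= rmorph_prod.
apply: eq_bigr => i _.
by rewrite rmorphB /= map_polyX map_polyC /= !mxE eqxx mulr1n DE mxE.
Qed.

Lemma dot_gt0 n (u : 'rV[R]_n) : u != 0 -> 0 < (u *m u^T) 0 0.
Proof.
move=> /rV0Pn[j uj]; rewrite mxE (bigD1 j) //= ltr_pwDl //.
  by rewrite mxE -expr2 exprn_even_gt0.
by apply: sumr_ge0 => i _; rewrite mxE -expr2 sqr_ge0.
Qed.

(* The span of [u] and [v] meets the hyperplane orthogonal to a first
   eigenvector; there the quadratic form is at least the second eigenvalue. *)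
Lemma second_eigenvalue_le n (A : 'M[R]_n) (u v : 'rV[R]_n) (c : R) :
  A^T = A -> u != 0 -> u *m A = 0 -> u *m v^T = 0 -> v != 0 -> 0 <= c ->
  (v *m A *m v^T) 0 0 <= c * (v *m v^T) 0 0 -> (eigenvalues A)`_1 <= c.
Proof.
move=> symA u0 uA uv v0 c0 vAv.
have [P [s [uP BE ps]]] := symmetric_spectral symA.
(* [i0] is one position carrying the least eigenvalue. Only one copy is removed, so a repeated least
   eigenvalue is handled too. *)
have [i0 i0P] : exists i0, forall i, i != i0 -> (eigenvalues A)`_1 <= s i.
  have := sorted_eigenvalues A; move: ps.
  case: (eigenvalues A) => [|a l] ps.
    have := perm_size ps; rewrite size_map size_enum_ord => n0.
    by case/rV0Pn: u0 => j _; have := leq_ltn_trans (leq0n j) (ltn_ord j);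
      rewrite -{1}n0.
  have : a \in [seq s i | i <- enum 'I_n] by rewrite -(perm_mem ps) mem_head.
  case/mapP => i0 _ ai0 /= pl; exists i0 => i ii0.
  have si : s i \in l.
    have : perm_eq (a :: l) (s i0 :: [seq s i | i <- rem i0 (enum 'I_n)]).
      by apply: perm_trans ps _; apply: (perm_map s (t := i0 :: _));
        rewrite perm_to_rem ?mem_enum.
    rewrite -ai0 perm_cons => /perm_mem ->; apply: map_f.
    by rewrite mem_rem_uniq ?enum_uniq // !inE ii0 mem_enum.
  move/path_sorted: pl; case: l si {ps} => //= b l.
  rewrite inE => /orP[/eqP->//|si].
  by move=> /(order_path_min le_trans) /allP; apply.
pose U := map_mx toC u; pose V := map_mx toC v; pose B := map_mx toC A.
have uu0 : 0 < (u *m u^T) 0 0 by exact: dot_gt0.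
have vv0 : 0 < (v *m v^T) 0 0 by exact: dot_gt0.
(* Coordinates of [x] in the orthonormal eigenbasis given by the rows of [P]. *)
pose z (x : 'rV[C]_n) := x *m P^t*.
have [a [b [ab0 abz]]] : exists a b : C, (a != 0) || (b != 0) /\
    a * z U 0 i0 + b * z V 0 i0 = 0.
  have [zU|zU] := eqVneq (z U 0 i0) 0.
    by exists 1, 0; rewrite oner_eq0 zU mulr0 mul0r addr0.
  by exists (- z V 0 i0), (z U 0 i0); rewrite zU orbT mulNr mulrC addNr.
pose w := a *: U + b *: V.
have zw0 : z w 0 i0 = 0.
  by rewrite -abz /z /w mulmxDl -!scalemxAl mxE [X in X + _]mxE [X in _ + X]mxE.
have wt : w^t* = a^* *: U^T + b^* *: V^T.
  apply/matrixP => i j; rewrite !mxE rmorphD !rmorphM.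
  by congr (_ * _ + _ * _); apply: conjc_real.
have UV : U *m V^T = 0 by rewrite map_trmx -map_mxM uv map_mx0.
have VU : V *m U^T = 0.
  by rewrite -[V]trmxK -trmx_mul UV trmx0.
have UB : U *m B = 0 by rewrite -map_mxM uA map_mx0.
have BU : B *m U^T = 0.
  by rewrite -[B]trmxK -trmx_mul /B map_trmx symA UB trmx0.
have dotC m (x y : 'M[R]_(1,m)) : (map_mx toC x *m (map_mx toC y)^T) 0 0
   = toC ((x *m y^T) 0 0).
  by rewrite map_trmx -map_mxM mxE.
have wBw : (w *m B *m w^t*) 0 0 = `|b| ^+ 2 * toC ((v *m A *m v^T) 0 0).
  rewrite wt mulmxDr -!scalemxAr -(mulmxA w) BU mulmx0 scaler0 add0r.
  rewrite /w mulmxDl -!scalemxAl UB scaler0 add0r -scalemxAl scalerA mxE.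
  by rewrite -map_mxM dotC mulrC normCK [b * _]mulrC mulrC.
have ww : (w *m w^t*) 0 0 =
    `|a| ^+ 2 * toC ((u *m u^T) 0 0) + `|b| ^+ 2 * toC ((v *m v^T) 0 0).
  rewrite wt /w mulmxDr -!scalemxAr !mulmxDl -!scalemxAl UV VU !scaler0.
  rewrite addr0 add0r !scalerA mxE [X in X + _]mxE [X in _ + X]mxE !dotC.
  by rewrite !normCK [a * _]mulrC [b * _]mulrC.
have toC_gt0 x : 0 < x -> 0 < toC x by rewrite -(ltcR 0).
have ww_gt0 : 0 < (w *m w^t*) 0 0.
  have sq_ge0 (x : C) : 0 <= `|x| ^+ 2 by rewrite exprn_ge0.
  have sq_gt0 (x : C) : x != 0 -> 0 < `|x| ^+ 2.
    by move=> x0; rewrite exprn_gt0 // normr_gt0.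
  rewrite ww; case/orP: ab0 => h; [rewrite ltr_pwDl // | rewrite ltr_wpDl //].
  - by rewrite mulr_gt0 ?toC_gt0 ?sq_gt0.
  - by rewrite mulr_ge0 // ltW // toC_gt0.
  - by rewrite mulr_ge0 // ltW // toC_gt0.
  - by rewrite mulr_gt0 ?toC_gt0 ?sq_gt0.
have ztE : (z w)^t* = P *m w^t* by rewrite /z trmx_mul map_mxM trmxCK.
have PP : P^t* *m P = 1%:M.
  by rewrite -invmx_unitary // mulVmx // unitarymx_unit.
have wwz : (w *m w^t*) 0 0 = \sum_i `|z w 0 i| ^+ 2.
  have wE : w = z w *m P by rewrite /z -mulmxA PP mulmx1.
  rewrite {1}wE -mulmxA -ztE mxE.
  by apply: eq_bigr => i _; rewrite !mxE normCK.
have wBwz : (w *m B *m w^t*) 0 0 = \sum_i toC (s i) * `|z w 0 i| ^+ 2.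
  rewrite /B BE !mulmxA -/(z w) -mulmxA -ztE mxE.
  by apply: eq_bigr => i _; rewrite mul_mx_diag !mxE normCK mulrCA mulrA.
(* Both sides are compared with the quadratic form at [w]. From below, the coordinate [i0] vanishes
   and every other coordinate has eigenvalue at least the second one. From above, the kernel vector
   [u] adds nothing to the form, while [0 <= c] makes its share of the norm harmless. *)
suff : toC (eigenvalues A)`_1 * (w *m w^t*) 0 0 <= toC c * (w *m w^t*) 0 0.
  by rewrite ler_pM2r // lecR.
apply: (@le_trans _ _ ((w *m B *m w^t*) 0 0)).
  rewrite wBwz wwz mulr_sumr; apply: ler_sum => i _.
  have [->|ii0] := eqVneq i i0; first by rewrite zw0 normr0 expr0n /= !mulr0.
  by rewrite ler_wpM2r ?exprn_ge0 // lecR i0P.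
rewrite wBw ww mulrDr -[leLHS]add0r lerD //.
  apply: mulr_ge0; first by rewrite (lecR 0).
  by apply: mulr_ge0; [exact: exprn_ge0 | exact/ltW/toC_gt0].
rewrite mulrCA; apply: ler_wpM2l; first by rewrite exprn_ge0.
by rewrite -(rmorphM toC) lecR.
Qed.

End SecondEigenvalue.

(** * The signed distance is 1-Lipschitz along edges *)

Section Distance.
Variables (T : finType) (e : rel T).

Lemma graph_dist_self x : graph_dist e x x = 0%N.
Proof.
have T0 : (0 < #|T|)%N by apply/card_gt0P; exists x.
rewrite /graph_dist; case: #|T| T0 => //= n _.
by rewrite (_ : [exists _, _] = true) //; apply/existsP; exists [tuple];
  rewrite /= eqxx.
Qed.

Lemma graph_dist_le x y : (graph_dist e x y <= #|T|)%N.
Proof. by rewrite -[leqRHS](size_iota 0) find_size. Qed.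

(** Prepend [x] to a shortest path from [y]. If the search from [y] fails, its distance is the
    default [#|T|], which bounds every distance. *)
Lemma graph_dist_edge x y z :
  e x y -> (graph_dist e x z <= (graph_dist e y z).+1)%N.
Proof.
move=> exy; set Q := fun x n =>
  [exists p : n.-tuple T, path e x p && (last x p == z)].
have dE u : graph_dist e u z = find (Q u) (iota 0 #|T|) by [].
have [hy|hy] := boolP (has (Q y) (iota 0 #|T|)); last first.
  rewrite [X in (_ <= X.+1)%N]dE hasNfind // size_iota.
  by rewrite ltnW // ltnS graph_dist_le.
have := nth_find 0 hy; rewrite -dE.
have lt : (graph_dist e y z < #|T|)%N.
  by rewrite dE -[ltnRHS](size_iota 0) -has_find.
rewrite nth_iota // add0n => /existsP[p /andP[pp lp]].
rewrite leqNgt; apply/negP => lt'.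
have lt2 : ((graph_dist e y z).+1 < #|T|)%N.
  by apply: leq_trans lt' (graph_dist_le _ _).
have := before_find 0 lt'; rewrite nth_iota // add0n => /negbT/negP; apply.
by apply/existsP; exists [tuple of y :: p]; rewrite /= exy pp.
Qed.

Lemma bigminn_le (I : eqType) (r : seq I) (P : pred I) (F : I -> nat) k x :
  x \in r -> P x -> (\big[minn/k]_(y <- r | P y) F y <= F x)%N.
Proof.
elim: r => // y r IH; rewrite inE big_cons => /orP[/eqP <- Px|xr Px].
  by rewrite Px geq_minl.
case: ifP => _; last exact: IH.
by rewrite geq_min IH // orbT.
Qed.

Lemma dist_to_in (S : {set T}) x : x \in S -> dist_to e S x = 0%N.
Proof.
move=> xS; apply/eqP; rewrite -leqn0 -[leqRHS](graph_dist_self x) /dist_to.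
exact: bigminn_le (mem_index_enum x) xS.
Qed.

Lemma dist_to_edge (S : {set T}) x y :
  e x y -> (dist_to e S x <= (dist_to e S y).+1)%N.
Proof.
move=> exy; rewrite /dist_to.
elim/big_rec2: _ => // z a b zS ab.
rewrite -minnSS leq_min; apply/andP; split.
  exact: leq_trans (geq_minl _ _) (graph_dist_edge _ exy).
exact: leq_trans (geq_minr _ _) ab.
Qed.

(** An edge leaving [Vp] must end in [S], where the distance is 0 and the sign is immaterial; all
    other edges join vertices of equal sign. *)
Lemma signed_dist_edge (S Vp Vm : {set T}) x y :
  symmetric e -> separates e S Vp Vm -> e x y ->
  `|signed_dist e S Vp x - signed_dist e S Vp y| <= 1.
Proof.
move=> se [cS dV nE] exy.
have eyx : e y x by rewrite se.
have := dist_to_edge S exy; have := dist_to_edge S eyx.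
have mem u v : e u v -> u \in Vp -> v \notin Vp -> v \in S.
  move=> euv up vp; apply: contraT => vS.
  have : v \in ~: S by rewrite inE.
  by rewrite cS inE (negbTE vp) /= => vm; have := nE _ _ up vm; rewrite euv.
rewrite /signed_dist; case: ifPn => xp; case: ifPn => yp.
- lia.
- by rewrite (dist_to_in (mem _ _ exy xp yp)); lia.
- by rewrite (dist_to_in (mem _ _ eyx yp xp)); lia.
- lia.
Qed.

End Distance.

(** * Lower bound for the variance of an integer function with small level sets *)

Section Variance.
Variable R : realType.

(** Squared mean plus variance: the mean is [x + (N - 1) / 2], and [N] consecutive integers have
    variance [(N^2 - 1) / 12]. *)
Lemma sum_consecutive_squares (x : R) N :
  \sum_(i < N) (x + i%:R) ^+ 2 =
  N%:R * (x + (N%:R - 1) / 2) ^+ 2 + N%:R * (N%:R ^+ 2 - 1) / 12.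
Proof.
elim: N => [|N IH]; first by rewrite big_ord0; field.
by rewrite big_ord_recr /= IH -natr1; field.
Qed.

(* Subtract N^2/4 from each term: the values in the window of N consecutive
   integers around m become nonpositive and are taken at most s times each, and
   the values outside the window become nonnegative. *)
Lemma sum_sqr_dist_lower (T : finType) (D : T -> int) (s N : nat) (m : R) :
  (forall k, #|[set x | D x == k]| <= s)%N ->
  #|T|%:R * (N%:R ^+ 2 / 4) - s%:R * (N%:R ^+ 3 / 6 + N%:R / 12)
    <= \sum_x ((D x)%:~R - m) ^+ 2.
Proof.
move=> Ds; pose t : R := N%:R ^+ 2 / 4.
(* The integers [a, ..., a + N - 1] are exactly those in the half-open interval from [m - N/2] to
   [m + N/2]. *)
pose a : int := Num.ceil (m - N%:R / 2).
have a_ge : m - N%:R / 2 <= a%:~R by exact: ceil_ge.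
have a_lt : a%:~R < m - N%:R / 2 + 1.
  by rewrite -ltrBlDr -(intrB _ a 1) ceilB1_lt.
pose h (k : int) : R := (k%:~R - m) ^+ 2 - t.
have inw (i : 'I_N) : h (a + i%:Z) <= 0.
  have iN : i%:R + 1 <= N%:R :> R by rewrite natr1 ler_nat.
  have i0 : 0 <= i%:R :> R by [].
  rewrite /h /t intrD -pmulrn; nra.
have outw k : (forall i : 'I_N, k != a + i%:Z) -> 0 <= h k.
  move=> ki.
  have [ka|ka] := ltP k a.
    have : k%:~R + 1 <= a%:~R :> R by rewrite -(intrD _ k 1) ler_int; lia.
    have : 0 <= N%:R :> R by [].
    rewrite /h /t; nra.
  have [kb|kb] := ltP k (a + N%:Z).
    have kN : (`|k - a| < N)%N by lia.
    by have := ki (Ordinal kN); rewrite /= => /eqP; lia.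
  have : a%:~R + N%:R <= k%:~R :> R by rewrite [N%:R]pmulrn -intrD ler_int.
  have : 0 <= N%:R :> R by [].
  rewrite /h /t; nra.
(* Each [x] hits at most one window value. As [h] is nonpositive there, counting each value a full
   [s] times only lowers the sum. *)
have sumh : \sum_(i < N) h (a + i%:Z) *+ s <= \sum_x h (D x).
  apply: (@le_trans _ _ (\sum_x \sum_(i < N | D x == a + i%:Z) h (a + i%:Z))).
    rewrite (exchange_big_dep predT) //=; apply: ler_sum => i _.
    rewrite sumr_const; apply: ler_wnMn2l; first exact: inw.
    by have := Ds (a + i%:Z); rewrite cardsE.
  apply: ler_sum => x _.
  have [/existsP[i /eqP Di]|/existsPn ni] :=
      boolP [exists i : 'I_N, D x == a + i%:Z].
    rewrite (big_pred1 i) ?Di // => j.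
    by apply/eqP/eqP => [ij|->//]; apply: val_inj => /=; lia.
  by rewrite big_pred0 ?outw // => i; apply/negbTE/ni.
have hE : \sum_(i < N) h (a + i%:Z) =
    N%:R * (a%:~R - m + (N%:R - 1) / 2) ^+ 2 + N%:R * (N%:R ^+ 2 - 1) / 12
    - N%:R * t.
  have -> : N%:R * t = \sum_(i < N) t by rewrite sumr_const card_ord mulr_natl.
  rewrite -sum_consecutive_squares -sumrB; apply: eq_bigr => i _.
  by rewrite /h intrD -pmulrn addrAC.
have DE : \sum_x h (D x) = \sum_x ((D x)%:~R - m) ^+ 2 - #|T|%:R * t.
  by rewrite sumrB sumr_const mulr_natl.
move: sumh; rewrite sumrMnl hE DE -mulr_natl /t.
set V := \sum_x _ => sumh.
(* Dropping the squared mean leaves [N (N^2 - 1) / 12 - N^3 / 4 = - (N^3 / 6 + N / 12)], multiplied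
   by [s]. *)
have : 0 <= s%:R * (N%:R * (a%:~R - m + (N%:R - 1) / 2) ^+ 2) :> R.
  by rewrite mulr_ge0 // mulr_ge0 // sqr_ge0.
lra.
Qed.

End Variance.

(** * The Dirichlet energy of a function on the graph *)

Section Energy.
Variables (R : realType) (T : finType) (e : rel T) (d : nat).
Implicit Types g : T -> R.

Lemma sum_enum_val (F : T -> R) : \sum_(i < #|T|) F (enum_val i) = \sum_x F x.
Proof. by rewrite -(big_enum_val (A := T)). Qed.

Lemma laplacian_mx_col g :
  laplacian_mx R e d *m (\col_j g (enum_val j)) =
  \col_i laplacian e d g (enum_val i).
Proof.
apply/colP => i; rewrite !mxE /laplacian.
set x := enum_val i.
under eq_bigr => j _ do rewrite !mxE -mulrA mulr_suml.
rewrite -mulr_sumr exchange_big /=; congr (_ * _); apply: eq_bigr => y _.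
rewrite (sum_enum_val (fun z => ((x == z)%:R - (y == z)%:R) * g z)).
under eq_bigr => z _ do rewrite mulrBl.
have pick a : \sum_z (a == z)%:R * g z = g a.
  rewrite (bigD1 a) //= eqxx mul1r big1 ?addr0 // => z za.
  by rewrite eq_sym (negbTE za) mul0r.
by rewrite sumrB !pick.
Qed.

(** Swapping the endpoints of the ordered edges and averaging turns [g x * (g x - g y)] into half of
    the square. *)
Lemma energyE g : symmetric e ->
  \sum_x g x * laplacian e d g x =
  (d%:R *+ 2)^-1 * \sum_x \sum_(y | e x y) (g x - g y) ^+ 2.
Proof.
move=> se.
pose Q := \sum_x \sum_(y | e x y) g x * (g x - g y).
have QE : \sum_x g x * laplacian e d g x = d%:R^-1 * Q.
  rewrite mulr_sumr; apply: eq_bigr => x _.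
  by rewrite /laplacian mulrCA mulr_sumr.
have Qsym : Q = \sum_x \sum_(y | e x y) g y * (g y - g x).
  rewrite /Q (exchange_big_dep predT) //=; apply: eq_bigr => x _.
  by apply: eq_bigl => y; rewrite se.
have -> : \sum_x \sum_(y | e x y) (g x - g y) ^+ 2 = Q *+ 2.
  rewrite mulr2n {2}Qsym -big_split /=; apply: eq_bigr => x _.
  by rewrite -big_split /=; apply: eq_bigr => y _; ring.
rewrite QE -[Q *+ 2]mulr_natr -[d%:R *+ 2]mulr_natr invfM -mulrA.
by congr (_ * _); field.
Qed.

Lemma energy_le g : symmetric e -> regular_graph e d ->
  (forall x y, e x y -> `|g x - g y| <= 1) ->
  \sum_x g x * laplacian e d g x <= #|T|%:R / 2.
Proof.
move=> se rg g1; rewrite energyE //.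
have le : \sum_x \sum_(y | e x y) (g x - g y) ^+ 2 <= #|T|%:R * d%:R.
  rewrite mulr_natl -sumr_const; apply: ler_sum => x _.
  rewrite -(rg x) cardsE -sum1_card natr_sum; apply: ler_sum => y exy.
  by rewrite -real_normK ?num_real // expr_le1 // g1.
apply: (@le_trans _ _ ((d%:R *+ 2)^-1 * (#|T|%:R * d%:R))).
  by rewrite ler_wpM2l // invr_ge0 mulrn_wge0.
(* For [d = 0] the factor [d] cannot be cancelled, but the left side is then 0. *)
have [->|d0] := eqVneq d 0%N; first by rewrite !mulr0 divr_ge0.
have : d%:R != 0 :> R by rewrite pnatr_eq0.
by move=> ?; rewrite le_eqVlt; apply/orP; left; apply/eqP; field.
Qed.

End Energy.

(* For [L = #|T| / s] the right-hand side is the bound of [sum_sqr_dist_lower]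
   divided by [s]. *)
Lemma variance_bound_ge (R : realFieldType) (L N : R) :
  4 <= N -> N <= L <= N + 1 ->
  L ^+ 3 / 16 <= L * (N ^+ 2 / 4) - (N ^+ 3 / 6 + N / 12).
Proof.
move=> N4 /andP[NL LN]; pose t := L - N.
have t0 : 0 <= t by rewrite subr_ge0.
have t1 : t <= 1 by rewrite lerBlDl.
have -> : L = N + t by rewrite /t addrC subrK.
(* The difference equals [N (N^2 - 16) / 48 + t N (N - 4) / 16 + 3 N t (1 - t) / 16 + N t / 16 + (4
   N - t^3) / 16], a sum of nonnegative terms. *)
rewrite -subr_ge0.
have N2 : 0 <= N ^+ 2 - 16 by nra.
have h1 : 0 <= N * (N ^+ 2 - 16) by rewrite mulr_ge0 //; lra.
have h2 : 0 <= t * N * (N - 4) by rewrite !mulr_ge0 //; lra.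
have h3 : 0 <= N * t * (1 - t) by rewrite !mulr_ge0 //; lra.
have h4 : t ^+ 3 <= 1 by rewrite expr_le1.
have h5 : 0 <= N * t by rewrite mulr_ge0 //; lra.
lra.
Qed.

(** * The Rayleigh quotient of the centred signed distance *)

Local Open Scope classical_set_scope.

Theorem theorem5p8 (R : realType) :
  exists o : R -> R,
    o a / a ^+ 2 @[a --> (0 : R)^'] --> (0 : R) /\
    forall (T : finType) (e : rel T) (d : nat) (S Vp Vm : {set T}),
      simple_graph e -> connected_graph e -> regular_graph e d ->
      S != finset.set0 -> separates e S Vp Vm ->
      let alpha : R := #|S|%:R / #|T|%:R in
      alpha < 1 / 4 ->
      (forall k : int,
         (#|[set x | signed_dist e S Vp x == k]%SET| <= #|S|)%N) ->
      lambda R e d 2 <= 8 * alpha ^+ 2 + o alpha.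
Proof.
exists (fun=> 0); split.
  by under eq_fun do rewrite mul0r; exact: cvg_cst.
move=> T e d S Vp Vm [se ie] _ rg S0 sepS alpha alpha_lt atoms; rewrite addr0.
pose D := signed_dist e S Vp.
have s_gt0 : (0 < #|S|)%N by rewrite card_gt0.
have n_gt0 : (0 < #|T|)%N by apply: leq_trans s_gt0 (max_card _).
have sR : 0 < #|S|%:R :> R by rewrite ltr0n.
have nR : 0 < #|T|%:R :> R by rewrite ltr0n.
pose m : R := (\sum_x (D x)%:~R) / #|T|%:R.
pose g x : R := (D x)%:~R - m.
pose V := \sum_x g x ^+ 2.
have V_ge : #|T|%:R / (16 * alpha ^+ 2) <= V.
  (* The window length is the integer part of [1 / alpha]; [alpha < 1 / 4] makes it at least 4. *)
  pose N := (#|T| %/ #|S|)%N.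
  have NL : N%:R <= #|T|%:R / #|S|%:R :> R.
    by rewrite ler_pdivlMr // -natrM ler_nat leq_trunc_div.
  have LN : #|T|%:R / #|S|%:R <= N%:R + 1 :> R.
    by rewrite ler_pdivrMr // natr1 -natrM ler_nat ltnW // ltn_ceil.
  have N4 : 4 <= N%:R :> R.
    rewrite ler_nat /N leq_divRL // -(ler_nat R) natrM.
    by move: alpha_lt; rewrite /alpha ltr_pdivrMr //; lra.
  have := variance_bound_ge (L := #|T|%:R / #|S|%:R) N4.
  rewrite NL LN => /(_ isT); rewrite -(ler_pM2l sR) => h.
  have := sum_sqr_dist_lower N m atoms.
  apply: le_trans; apply: le_trans (le_trans h _).
    by rewrite /alpha le_eqVlt; apply/orP; left; apply/eqP; field; lra.
  by rewrite le_eqVlt; apply/orP; left; apply/eqP; field; lra.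
have a_gt0 : 0 < alpha by rewrite divr_gt0.
have V_gt0 : 0 < V.
  by apply: lt_le_trans V_ge; rewrite divr_gt0 // mulr_gt0 // exprn_gt0.
pose v : 'rV[R]_#|T| := \row_j g (enum_val j).
have vT : v^T = \col_j g (enum_val j) by apply/colP => j; rewrite !mxE.
have vv : (v *m v^T) 0 0 = V.
  rewrite mxE -[RHS](sum_enum_val (fun x => g x ^+ 2)).
  by apply: eq_bigr => j _; rewrite !mxE expr2.
(* Constants span the kernel direction, and [v] is orthogonal to them because [m] is the mean of
   [D]. *)
apply: (@second_eigenvalue_le R #|T| _ (const_mx 1) v).
- exact: laplacian_mx_sym.
- by apply/rV0Pn; exists (Ordinal n_gt0); rewrite mxE oner_eq0.
- apply: trmx_inj; rewrite trmx_mul laplacian_mx_sym // trmx0.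
  have -> : (const_mx 1)^T = \col_j (fun=> 1) (enum_val j) :> 'cV[R]_#|T|.
    by apply/colP => j; rewrite !mxE.
  rewrite (laplacian_mx_col e d (fun=> 1)).
  apply/colP => j; rewrite !mxE /laplacian.
  by rewrite big1 ?mulr0 // => y _; rewrite subrr.
- apply/matrixP => i j; rewrite !ord1 mxE [RHS]mxE.
  under eq_bigr => k _ do rewrite !mxE mul1r.
  rewrite (sum_enum_val g) /g sumrB sumr_const -mulr_natr divfK ?subrr //.
  by rewrite lt0r_neq0.
- by apply: contraTneq V_gt0 => v0; rewrite -vv v0 mul0mx mxE ltxx.
- by rewrite mulr_ge0 // sqr_ge0.
- have -> : (v *m laplacian_mx R e d *m v^T) 0 0 =
      \sum_x g x * laplacian e d g x.
    rewrite -mulmxA vT laplacian_mx_col mxE.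
    rewrite -[RHS](sum_enum_val (fun x => g x * laplacian e d g x)).
    by apply: eq_bigr => j _; rewrite !mxE.
  rewrite vv; apply: le_trans (energy_le se rg _) _ => [x y exy|].
    have := signed_dist_edge se sepS exy.
    by rewrite /g opprB addrA subrK -intrB -intr_norm (ler_int R _ 1).
  (* The energy is at most [#|T| / 2], and [V_ge] says precisely that this is at most
     [8 * alpha ^+ 2 * V]. *)
  have := V_ge; rewrite ler_pdivrMr; last by rewrite mulr_gt0 // exprn_gt0.
  rewrite -[in X in _ -> X](ler_pM2r (ltr0n R 2)) divfK ?pnatr_eq0 //.
  by rewrite (_ : 8 * _ * _ * _ = V * (16 * alpha ^+ 2)) //; ring.
Qed.
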